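(* Let $K$ be a function field with full constant field $\mathbb{F}_q$ of characteristic $3$, let $L/K$ be a separable extension of degree $3$, and let $y$ be a primitive element with minimal polynomial $X^3+aX+a^2$, $a\in K$. Let $\mathfrak{p}$ be a place of $K$. Then $\mathfrak{p}$ is fully ramified in $L$ if, and only if, there exist $w\in K$ and $j\in\{1,2\}$ such that, with $$\alpha=\frac{(ja^2+(w^3+aw))^2}{a^3},$$ one has $v_{\mathfrak{p}}(\alpha)<0$ and $\gcd(v_{\mathfrak{p}}(\alpha),3)=1$. Equivalently, $\mathfrak{p}$ is fully ramified if, and only if, there is a generator $z$ of $L/K$ with minimal polynomial $X^3+\alpha X+\alpha^2$ where $v_{\mathfrak{p}}(\alpha)<0$ and $\gcd(v_{\mathfrak{p}}(\alpha),3)=1$.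
   Context: $v_{\mathfrak{p}}$ is the normalized valuation at $\mathfrak{p}$; fully ramified means some place of $L$ above $\mathfrak{p}$ has ramification index $3$. *)

(* Defs.v *)
From HB Require Import structures.
From mathcomp Require Import all_boot all_order all_algebra all_field.
From mathcomp Require Import boolp classical_sets.

Set Implicit Arguments.
Unset Strict Implicit.
Unset Printing Implicit Defensive.

Import Order.TTheory GRing.Theory Num.Theory.

Local Open Scope classical_set_scope.
Local Open Scope ring_scope.

Section FunctionField.
Variables (F K : fieldType) (i : {rmorphism F -> K}).

(* [rational_in x] is the subfield F(x) of K, with F embedded in K by [i]. *)
Definition rational_in (x : K) : set K :=
  [set z | exists p q : {poly F},
     (map_poly i q).[x] != 0 /\ z = (map_poly i p).[x] / (map_poly i q).[x]].

(* K is a finite extension of F(x) for some x transcendental over F; [e] is a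
   finite family spanning K over F(x). *)
Definition function_field : Prop :=
  exists x : K, ~ algebraicOver i x /\
    exists (n : nat) (e : 'I_n -> K), forall z : K,
      exists c : 'I_n -> K,
        (forall j, rational_in x (c j)) /\ z = \sum_(j < n) c j * e j.

Definition full_constant_field : Prop :=
  forall z : K, algebraicOver i z -> exists c : F, z = i c.

End FunctionField.

Section Places.
Variables (F K : fieldType) (i : F -> K).

Definition valuation_ring (O : set K) : Prop :=
  [/\ [/\ O 1, (forall x y, O x -> O y -> O (x - y))
        & (forall x y, O x -> O y -> O (x * y))],
      range i `<` O, O `<` setT
    & forall z, O z \/ O z^-1].

(* Units of O; since 0^-1 = 0, the condition z != 0 cannot be dropped. *)
Definition unit_of (O : set K) : set K :=
  [set z | [/\ O z, z != 0 & O z^-1]].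

(* A place is the maximal ideal of a valuation ring O. It is represented by O;
   as O is local, the maximal ideal is the set of non-units of O. *)
Record place := Place {
  place_ring : set K;
  place_ringP : valuation_ring place_ring }.

Definition place_ideal (P : place) : set K :=
  place_ring P `\` unit_of (place_ring P).

(* t generates the maximal ideal: P = t O. *)
Definition uniformizer (P : place) (t : K) : Prop :=
  place_ideal P = [set t * x | x in place_ring P].

(* The normalized valuation at P: the n such that z = t^n u with t a
   uniformizer and u a unit of the valuation ring. For z = 0 there is no such
   n, and the value +oo is replaced by the default 0, which is not negative
   either. *)
Definition pval (P : place) (z : K) : int :=
  xget (0 : int) [set n : int | exists t u : K,
    [/\ uniformizer P t, unit_of (place_ring P) u & z = t ^ n * u]].

End Places.

Section Ramification.
Variables (F K : fieldType) (i : F -> K) (L : fieldExtType K).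

(* Constants of L: the embedding F -> K -> L. *)
Definition ext_const (c : F) : L := (i c)%:A.

Definition lies_above (Q : place ext_const) (P : place i) : Prop :=
  forall x : K, place_ideal P x -> place_ideal Q x%:A.

(* The e such that v_Q(x) = e v_P(x) for all nonzero x in K. *)
Definition ramification_index (Q : place ext_const) (P : place i) : nat :=
  xget 0%N [set e : nat |
    forall x : K, x != 0 -> pval Q x%:A = e%:Z * pval P x].

Definition fully_ramified (P : place i) : Prop :=
  exists Q : place ext_const, lies_above Q P /\ ramification_index Q P = 3%N.

(* z generates L over K and has minimal polynomial X^3 + c X + c^2. *)
Definition generator_with_minpoly (z : L) (c : K) : Prop :=
  <<1; z>>%VS = {:L}%VS /\
  minPoly 1 z = map_poly (in_alg L) ('X^3 + c *: 'X + (c ^+ 2)%:P).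

End Ramification.

(* Main.v *)
(** A place P of K is discrete, and so is every place of L above it, because all
    elements satisfy relations of bounded degree over F[x], resp. over K, whose
    coefficients have values in a cyclic group.

    If P is fully ramified, with V the valuation of L above P, then V(K) = 3Z and
    the residue degree is 1.  As long as V(y - w) is divisible by 3, w can be
    improved to a better approximation of y in K; this cannot go on forever, since
    V would then take all its values on K.  Once V(y - w) is prime to 3, the
    equation of y - w forces v(alpha) = 2 V(y - w) - 3 v(a) < 0 for j = 1.

    For any w and j, a multiple of w - j y is a generator with coefficient alpha.

    Conversely, a generator z with v(alpha) < 0 prime to 3 gives the ring of all x
    in L whose norm is integral at P.  The three pure terms of the norm form in the
    basis 1, z, z^2 have values that are distinct modulo 3, and they dominate the
    mixed terms; hence this ring is closed under subtraction, and it is a valuation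
    ring with v_Q = v o N, so that v_Q = 3 v on K. *)

Require Import Defs.
From mathcomp Require Import all_boot all_order all_algebra all_field.
From mathcomp Require Import boolp classical_sets zify ring.
Import Order.TTheory GRing.Theory Num.Theory.
Local Open Scope ring_scope.
Set Implicit Arguments.
Unset Strict Implicit.
Unset Printing Implicit Defensive.

(** * Valuation rings: units, non-units and dominant terms of sums *)

Section ValuationRing.
Variables (F E : fieldType) (i : F -> E) (O : set E).
Hypothesis valO : valuation_ring i O.
Implicit Types (x y z u : E).

Lemma vring1 : O 1. Proof. by case: valO => -[]. Qed.

Lemma vringB x y : O x -> O y -> O (x - y).
Proof. by case: valO => -[_ + _] _ _ _; apply. Qed.

Lemma vringM x y : O x -> O y -> O (x * y).
Proof. by case: valO => -[_ _ +] _ _ _; apply. Qed.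

Lemma vring0 : O 0.
Proof. by rewrite -(subrr 1); apply: vringB; exact: vring1. Qed.

Lemma vringN x : O x -> O (- x).
Proof. by rewrite -sub0r; apply: vringB; exact: vring0. Qed.

Lemma vringD x y : O x -> O y -> O (x + y).
Proof. by move=> Ox Oy; rewrite -(opprK y); apply/vringB/vringN. Qed.

Lemma vringX x n : O x -> O (x ^+ n).
Proof.
by move=> Ox; elim: n => [|n IH]; [exact: vring1 | rewrite exprS; exact: vringM].
Qed.

Lemma vring_const c : O (i c).
Proof. by case: valO => _ [sub _] _ _; apply: sub; exists c. Qed.

Lemma vring_or x : O x \/ O x^-1.
Proof. by case: valO. Qed.

Lemma vring_proper : exists x, ~ O x.
Proof.
apply: contrapT => /forallNP allO; case: valO => _ _ [_ nsub] _.
by apply: nsub => x _; apply: contrapT; exact: allO.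
Qed.

Lemma vunit1 : unit_of O 1.
Proof. by split; rewrite ?invr1 ?oner_neq0 //; exact: vring1. Qed.

Lemma vunitM x y : unit_of O x -> unit_of O y -> unit_of O (x * y).
Proof.
move=> [Ox x0 Ox'] [Oy y0 Oy']; split; first exact: vringM.
  by rewrite mulf_neq0.
by rewrite invfM; exact: vringM.
Qed.

Lemma vunitV x : unit_of O x -> unit_of O x^-1.
Proof. by move=> [Ox x0 Ox']; split; rewrite ?invr_eq0 ?invrK. Qed.

Lemma vunitX x n : unit_of O x -> unit_of O (x ^+ n).
Proof.
by move=> Ux; elim: n => [|n IH]; [exact: vunit1 | rewrite exprS; exact: vunitM].
Qed.

(** The inverse of [x] is [x ^+ n.-1] times the inverse of [x ^+ n], so it lies in [O] if [x] does;
    the other case is symmetric. *)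
Lemma vunitXV x n : (0 < n)%N -> unit_of O (x ^+ n) -> unit_of O x.
Proof.
move=> n0 [Oxn xn0 Oxn'].
have x0 : x != 0 by move: xn0; rewrite expf_eq0 n0.
have e : x ^+ n = x * x ^+ n.-1 by rewrite -exprS prednK.
have [Ox|Ox] := vring_or x.
  split=> //; have -> : x^-1 = (x ^+ n)^-1 * x ^+ n.-1.
    by rewrite e; field; rewrite x0 expf_neq0.
  exact/vringM/vringX.
split=> //; have -> : x = x ^+ n * x^-1 ^+ n.-1.
  by rewrite e exprVn; field; rewrite expf_neq0.
exact/vringM/vringX.
Qed.

Lemma vunitN x : unit_of O x -> unit_of O (- x).
Proof. by move=> [Ox x0 Ox']; split; rewrite ?oppr_eq0 ?invrN //; exact: vringN. Qed.

Lemma vnonunitN x : ~ unit_of O x -> ~ unit_of O (- x).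
Proof. by move=> nx /vunitN; rewrite opprK. Qed.

Lemma vnonunitM x y : O x -> O y -> ~ unit_of O y -> ~ unit_of O (x * y).
Proof.
move=> Ox Oy ny [_ xy0 Oi]; apply: ny; move: xy0; rewrite mulf_eq0 negb_or => /andP[x0 y0].
split=> //; have -> : y^-1 = x * (x * y)^-1 by field; rewrite ?x0 ?y0.
exact: vringM.
Qed.

(** One of the two elements divides the other in [O]; factoring it out leaves a multiple of a
    non-unit. *)
Lemma vnonunitD x y : O x -> O y ->
  ~ unit_of O x -> ~ unit_of O y -> ~ unit_of O (x + y).
Proof.
wlog Oxy : x y / O (x / y).
  move=> H; have [Oq|] := vring_or (x / y); first exact: H.
  by rewrite invf_div addrC => Oq Ox Oy nx ny; apply: H.
move=> Ox Oy nx ny; have [->|y0] := eqVneq y 0; first by rewrite addr0.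
have -> : x + y = (x / y + 1) * y by field.
by apply: vnonunitM => //; apply: vringD => //; exact: vring1.
Qed.

Lemma vunitD x y : unit_of O x -> O y -> ~ unit_of O y -> unit_of O (x + y).
Proof.
move=> Ux Oy ny; have [Ox x0 Ox'] := Ux; apply: contrapT => nxy.
have := vnonunitD (vringD Ox Oy) (vringN Oy) nxy (vnonunitN ny).
by rewrite addrK.
Qed.

Lemma nvringV x : ~ O x -> [/\ x != 0, O x^-1 & ~ unit_of O x^-1].
Proof.
move=> nOx; split.
- by apply/eqP => x0; apply: nOx; rewrite x0; exact: vring0.
- by have [] := vring_or x.
- by move=> [_ _]; rewrite invrK.
Qed.

Lemma vring_quot_or x y : O (x / y) \/ O (y / x).
Proof. by rewrite -[y / x]invf_div; exact: vring_or. Qed.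

(** No valuation is available yet, so distinct values are expressed by quotients that are non-units.
    By induction, the new term is compared with the dominant one among the earlier terms, and the
    one of smaller value dominates the longer sum. *)
Lemma sum_dominant n (b : nat -> E) :
  (exists k, (k < n)%N /\ b k != 0) ->
  (forall j k, (j < k)%N -> (k < n)%N -> b j != 0 -> b k != 0 ->
     ~ unit_of O (b k / b j)) ->
  exists k, [/\ (k < n)%N, b k != 0, unit_of O ((\sum_(j < n) b j) / b k)
    & forall j, (j < n)%N -> O (b j / b k)].
Proof.
elim: n => [[k []//]|n IH] ex sep.
have sep' j k : (j < k)%N -> (k < n)%N -> b j != 0 -> b k != 0 ->
     ~ unit_of O (b k / b j).
  by move=> jk kn; apply: sep => //; rewrite ltnS ltnW.
have [ex'|nex] := pselect (exists k, (k < n)%N /\ b k != 0); last first.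
  have z k : (k < n)%N -> b k = 0.
    by move=> kn; apply/eqP; apply: contrapT => /negP bk; apply: nex; exists k.
  have bn : b n != 0.
    have [k []] := ex; rewrite ltnS leq_eqVlt => /orP[/eqP->//|/z ->].
    by rewrite eqxx.
  exists n; split=> //.
    rewrite big_ord_recr /= big1 => [|j _]; last exact: z.
    by rewrite add0r divff //; exact: vunit1.
  move=> j; rewrite ltnS leq_eqVlt => /orP[/eqP->|/z ->].
    by rewrite divff //; exact: vring1.
  by rewrite mul0r; exact: vring0.
have [k [kn bk Uk dom]] := IH ex' sep'.
rewrite big_ord_recr /=; set S := \sum_(_ < _) _ in Uk *.
have [bn|bn] := eqVneq (b n) 0.
  exists k; split=> //; first exact: ltnW.
    by rewrite bn addr0.
  move=> j; rewrite ltnS leq_eqVlt => /orP[/eqP->|/dom//].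
  by rewrite bn mul0r; exact: vring0.
have nU : ~ unit_of O (b n / b k) by apply: sep.
have [On|Ok] := vring_quot_or (b n) (b k).
  exists k; split=> //; first exact: ltnW.
    by rewrite mulrDl; apply: vunitD.
  by move=> j; rewrite ltnS leq_eqVlt => /orP[/eqP->|/dom//].
exists n; split=> //.
  rewrite addrC mulrDl divff //; apply: vunitD => //; first exact: vunit1.
    have -> : S / b n = S / b k * (b k / b n) by field; rewrite bn bk.
    by have [OS _ _] := Uk; apply: vringM.
  have -> : S / b n = S / b k * (b k / b n) by field; rewrite bn bk.
  have [OS _ _] := Uk; apply: vnonunitM => // /vunitV.
  by rewrite invf_div.
move=> j; rewrite ltnS leq_eqVlt => /orP[/eqP->|/dom Oj].
  by rewrite divff //; exact: vring1.
have -> : b j / b n = b j / b k * (b k / b n) by field; rewrite bn bk.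
exact: vringM.
Qed.

(** Two terms of a vanishing sum must have the same value, since otherwise a dominant term would
    make the sum nonzero. Their quotient gives the value of a power of [z] in terms of
    coefficients. *)
Lemma relation_value n (c : nat -> E) z : z != 0 ->
  (exists k, (k < n)%N /\ c k != 0) -> \sum_(k < n) c k * z ^+ k = 0 ->
  exists j k, [/\ (j < k)%N, (k < n)%N, c j != 0, c k != 0
    & unit_of O (z ^+ (k - j) * (c k / c j))].
Proof.
move=> z0 [k0 [k0n ck0]] S0; apply: contrapT => nex.
have [||k [_ _ [_ + _] _]] := @sum_dominant n (fun k => c k * z ^+ k).
- by exists k0; rewrite mulf_neq0 ?expf_neq0.
- move=> j k jk kn; rewrite !mulf_eq0 !negb_or => /andP[cj _] /andP[ck _] U.
  apply: nex; exists j, k; split=> //.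
  suff -> : z ^+ (k - j) * (c k / c j) = c k * z ^+ k / (c j * z ^+ j) by [].
  have -> : z ^+ k = z ^+ (k - j) * z ^+ j by rewrite -exprD subnK // ltnW.
  by field; rewrite cj expf_neq0.
- by rewrite S0 mul0r eqxx.
Qed.

End ValuationRing.

(** * Normalized discrete valuations *)

(** The ultrametric inequality follows from [nvO] when [O] is a valuation ring, being closed under
    sums. The value at 0 is arbitrary. *)
Record normalized_valuation (E : fieldType) (O : set E) (V : E -> int) : Prop :=
  NormalizedValuation {
    nvM : forall x y, x != 0 -> y != 0 -> V (x * y) = V x + V y;
    nvO : forall x, x != 0 -> O x <-> 0 <= V x;
    nv_uniformizer : exists2 t, t != 0 & V t = 1 }.

Section NormalizedValuation.
Variables (F E : fieldType) (i : F -> E) (O : set E) (V : E -> int).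
Hypotheses (valO : valuation_ring i O) (nv : normalized_valuation O V).
Implicit Types (x y z u : E).

Lemma nv1 : V 1 = 0.
Proof.
have : V (1 * 1) = V 1 + V 1 by apply: (nvM nv); exact: oner_neq0.
by rewrite mulr1; lia.
Qed.

Lemma nvV x : x != 0 -> V x^-1 = - V x.
Proof.
move=> x0; have := nvM nv x0 (invr_neq0 x0).
by rewrite divff // nv1; lia.
Qed.

Lemma nvX x n : x != 0 -> V (x ^+ n) = n%:Z * V x.
Proof.
move=> x0; elim: n => [|n IH]; first by rewrite nv1 mul0r.
by rewrite exprS (nvM nv) ?expf_neq0 // IH; lia.
Qed.

Lemma nvXz x (n : int) : x != 0 -> V (x ^ n) = n * V x.
Proof.
move=> x0; case: n => n; first exact: nvX.
by rewrite NegzE -exprnN nvV ?expf_neq0 // nvX // mulNr.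
Qed.

Lemma nvN x : V (- x) = V x.
Proof.
have [->|x0] := eqVneq x 0; first by rewrite oppr0.
have N1 : (-1 : E) != 0 by rewrite oppr_eq0 oner_neq0.
have := nvX 2 N1; rewrite sqrrN expr1n nv1 => V1.
by rewrite -mulN1r (nvM nv) //; lia.
Qed.

Lemma nv_unit u : unit_of O u <-> u != 0 /\ V u = 0.
Proof.
split=> [[Ou u0 Ou']|[u0 Vu]].
  by split=> //; move: Ou Ou'; rewrite !(nvO nv) ?invr_eq0 // nvV //; lia.
by split=> //; rewrite (nvO nv) ?invr_eq0 // ?nvV // Vu.
Qed.

Lemma nv_nonunit x : x != 0 -> O x /\ ~ unit_of O x <-> 1 <= V x.
Proof.
move=> x0; rewrite (nvO nv) // nv_unit; split=> [[V0 nu]|V1].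
  have V0' : V x <> 0 by move=> Vx; apply: nu.
  lia.
by split=> [|[_]]; lia.
Qed.

Lemma nv_elt (n : int) : exists2 t, t != 0 & V t = n.
Proof.
have [t t0 Vt] := nv_uniformizer nv; exists (t ^ n); first exact: expfz_neq0.
by rewrite nvXz // Vt mulr1.
Qed.

(* [vge n x] means v(x) >= n, with the convention v(0) = +oo. *)
Definition vge (n : int) x := x = 0 \/ n <= V x.

Lemma vge_refl x : vge (V x) x. Proof. by right. Qed.

Lemma vge_le m n x : m <= n -> vge n x -> vge m x.
Proof. by move=> mn [->|nx]; [left | right; apply: le_trans nx]. Qed.

Lemma vge_ring x : O x <-> vge 0 x.
Proof.
have [->|x0] := eqVneq x 0.
  by split=> _; [left | exact: vring0 valO].
rewrite (nvO nv) //; split=> [|[x0'|]]; [by right | | by []].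
by move: x0; rewrite x0' eqxx.
Qed.

Lemma vgeP n x t : t != 0 -> V t = n -> vge n x <-> O (x / t).
Proof.
move=> t0 Vt; have [->|x0] := eqVneq x 0.
  by rewrite mul0r; split=> _; [exact: vring0 valO | left].
rewrite (nvO nv) ?mulf_neq0 ?invr_eq0 // (nvM nv) ?invr_eq0 // nvV // Vt.
split=> [[x0'|]|]; [by move: x0; rewrite x0' eqxx | lia | by move=> H; right; lia].
Qed.

Lemma vgeD n x y : vge n x -> vge n y -> vge n (x + y).
Proof.
have [t t0 Vt] := nv_elt n; rewrite !(vgeP _ t0 Vt) mulrDl.
exact: vringD valO _ _.
Qed.

Lemma vgeN n x : vge n x -> vge n (- x).
Proof. by move=> [->|nx]; [left; rewrite oppr0 | right; rewrite nvN]. Qed.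

Lemma vgeB n x y : vge n x -> vge n y -> vge n (x - y).
Proof. by move=> nx ny; apply/vgeD/vgeN. Qed.

Lemma vgeM m n x y : vge m x -> vge n y -> vge (m + n) (x * y).
Proof.
move=> mx ny; have [->|x0] := eqVneq x 0; first by rewrite mul0r; left.
have [->|y0] := eqVneq y 0; first by rewrite mulr0; left.
case: mx => [x0'|mx]; first by move: x0; rewrite x0' eqxx.
case: ny => [y0'|ny]; first by move: y0; rewrite y0' eqxx.
by right; rewrite (nvM nv) //; exact: lerD.
Qed.

(** A larger value of [x + y] would carry over to [x = (x + y) - y], as [y] has a larger value
    too. *)
Lemma nv_dominant x y : x != 0 -> vge (V x + 1) y -> x + y != 0 /\ V (x + y) = V x.
Proof.
move=> x0 gy.
have nge z : vge (V x + 1) z -> x <> z.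
  by move=> + xz; rewrite -xz => -[x0'|]; [move: x0; rewrite x0' eqxx | lia].
have xy0 : x + y != 0.
  by rewrite addr_eq0; apply/eqP/nge/vgeN.
split=> //; apply/eqP; rewrite eq_le; apply/andP; split.
  rewrite leNgt; apply/negP => lt.
  apply: (nge (x + y - y)); last by rewrite addrK.
  by apply: vgeB => //; right; lia.
have [/eqP|//] : vge (V x) (x + y); last by rewrite (negPf xy0).
by apply: vgeD; [right | apply: vge_le gy; lia].
Qed.

Lemma nv_sum_dominant n (b : nat -> E) :
  (exists k, (k < n)%N /\ b k != 0) ->
  (forall j k, (j < k)%N -> (k < n)%N -> b j != 0 -> b k != 0 -> V (b k) <> V (b j)) ->
  exists k, [/\ (k < n)%N, b k != 0, \sum_(j < n) b j != 0,
    V (\sum_(j < n) b j) = V (b k) & forall j, (j < n)%N -> vge (V (b k)) (b j)].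
Proof.
move=> ex sep; have [//||k [kn bk Uk dom]] := sum_dominant valO (n := n) (b := b).
  move=> j k jk kn bj bk /nv_unit[_].
  by rewrite (nvM nv) ?invr_eq0 // nvV // => /eqP; rewrite subr_eq0 => /eqP; apply: sep.
have S0 : \sum_(j < n) b j != 0.
  by have [_ + _] := Uk; rewrite mulf_eq0 negb_or => /andP[].
exists k; split=> // [|j jn]; last by apply/(vgeP _ bk erefl)/dom.
by have /nv_unit[_] := Uk; rewrite (nvM nv) ?invr_eq0 // nvV //; lia.
Qed.

End NormalizedValuation.

(** * Comparison of [pval] with a normalized valuation *)

Section PlaceValuation.
Variables (F E : fieldType) (i : F -> E) (P : place i) (V : E -> int).
Hypothesis nv : normalized_valuation (place_ring P) V.

Lemma place_idealP x : place_ideal P x <-> vge V 1 x.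
Proof.
have [->|x0] := eqVneq x 0.
  split=> _; first by left.
  by split; [exact: vring0 (place_ringP P) | case; rewrite eqxx].
split=> [[Ox nx]|[/eqP|]]; last 2 first.
- by rewrite (negPf x0).
- by move/(nv_nonunit nv x0) => [].
by right; apply/(nv_nonunit nv x0).
Qed.

(** If [t] generates the ideal, an element of value 1 is a multiple of it, so [V t <= 1]; membership
    in the ideal gives the other bound. *)
Lemma uniformizerP t : uniformizer P t <-> t != 0 /\ V t = 1.
Proof.
have valP := place_ringP P.
split=> [tP|[t0 Vt]]; last first.
  apply/seteqP; split=> x.
    move/place_idealP/(vgeP valP nv _ t0 Vt) => Ox; exists (x / t) => //.
    by field.
  move=> [y Oy <-]; apply/place_idealP.
  by rewrite -[1]addr0; apply: (vgeM nv); [right; rewrite Vt | apply/(vge_ring valP nv)].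
have [s s0 Vs] := nv_uniformizer nv.
have [y Oy ys] : [set t * x | x in place_ring P]%classic s.
  by rewrite -tP; apply/place_idealP; right; rewrite Vs.
have /andP[t0 y0] : (t != 0) && (y != 0).
  by move: s0; rewrite -ys mulf_eq0 negb_or.
split=> //; move: Oy; rewrite (nvO nv) // => Vy.
have : place_ideal P t.
  by rewrite tP; exists 1; rewrite ?mulr1 //; exact: vring1 valP.
move/place_idealP => [/eqP|]; first by rewrite (negPf t0).
by move: Vs; rewrite -ys (nvM nv) //; lia.
Qed.

(** By [uniformizerP] every admissible [t] has value 1, so [V x] is the only exponent that the
    choice in [pval] can return. *)
Lemma pvalE x : x != 0 -> pval P x = V x.
Proof.
move=> x0; apply: xget_unique => [|n [t [u [/uniformizerP[t0 Vt] /(nv_unit nv)[u0 Vu] ->]]]].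
  have [t t0 Vt] := nv_uniformizer nv.
  exists t, (x / t ^ V x); split; first exact/uniformizerP.
    apply/(nv_unit nv); split; first by rewrite mulf_neq0 ?invr_eq0 ?expfz_neq0.
    by rewrite (nvM nv) ?(nvV nv) ?(nvXz nv) ?invr_eq0 ?expfz_neq0 // Vt; lia.
  by field; rewrite expfz_neq0.
by rewrite (nvM nv) ?(nvXz nv) ?expfz_neq0 // Vt Vu; lia.
Qed.

End PlaceValuation.

(** * Discreteness from relations of bounded degree *)

Section Discreteness.
Variables (F E : fieldType) (i : F -> E) (O : set E).
Hypothesis valO : valuation_ring i O.
Variables (pi : E) (C : set E) (n : nat).
Hypotheses (pi0 : pi != 0) (npi : ~ O pi^-1).
Hypothesis C_val : forall c, C c -> c != 0 -> exists m : int, unit_of O (c / pi ^ m).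
Hypothesis C_rel : forall z, z != 0 -> exists c : nat -> E,
  [/\ forall k, C (c k), exists k, (k < n.+1)%N /\ c k != 0
    & \sum_(k < n.+1) c k * z ^+ k = 0].

Let Opi : O pi. Proof. by have [_ +] := nvringV valO npi; rewrite invrK. Qed.

Let ring_pi (m : int) : O (pi ^ m) <-> 0 <= m.
Proof.
case: m => m; first by split=> // _; exact: (vringX valO).
split=> // O1; exfalso; apply: npi.
have -> : pi^-1 = pi ^ (Negz m) * pi ^+ m.
  by rewrite NegzE -exprnN exprS; field; rewrite pi0 expf_neq0.
exact/(vringM valO)/(vringX valO).
Qed.

Let unit_pi (m : int) : unit_of O (pi ^ m) -> m = 0.
Proof. by move=> [/ring_pi m0 _]; rewrite invr_expz => /ring_pi; lia. Qed.

(** A relation with coefficients in [C] gives some [z ^+ (k - j)] the value of a power of [pi].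
    Since [k - j] is at most [n], it divides the factorial of [n], and this one exponent serves
    every [z]. *)
Let value_power z : z != 0 -> exists m : int, unit_of O (z ^+ n`! / pi ^ m).
Proof.
move=> z0; have [c [Cc ex S0]] := C_rel z0.
have [j [k [jk kn cj ck U]]] := relation_value valO z0 ex S0.
have [mj Uj] := C_val (Cc j) cj; have [mk Uk] := C_val (Cc k) ck.
have /dvdnP[q ->] : (k - j %| n`!)%N by apply: dvdn_fact; lia.
exists (((mj - mk) * q)%R); rewrite mulnC exprM.
have -> : pi ^ ((mj - mk) * q) = (pi ^ (mj - mk)) ^+ q by rewrite -exprz_exp.
rewrite -expr_div_n; apply: (vunitX valO).
have -> : z ^+ (k - j) / pi ^ (mj - mk) =
   z ^+ (k - j) * (c k / c j) * (c j / pi ^ mj) * (c k / pi ^ mk)^-1.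
  by rewrite expfzDr // -invr_expz; field; rewrite cj ck !expfz_neq0.
exact: (vunitM valO (vunitM valO U Uj) (vunitV Uk)).
Qed.

(** Measured in powers of [pi], the value of the factorial power of [z] is a homomorphism [W] to the
    integers. Its image is generated by its least positive element, and division by that element
    normalizes it. *)
Lemma exists_normalized_valuation : exists V, normalized_valuation O V.
Proof.
have /choice[W HW] : forall z, exists m : int, z != 0 -> unit_of O (z ^+ n`! / pi ^ m).
  move=> z; have [->|z0] := eqVneq z 0; first by exists 0.
  by have [m Um] := value_power z0; exists m.
have WU z m : z != 0 -> unit_of O (z ^+ n`! / pi ^ m) -> W z = m.
  move=> z0 Um; apply/eqP; rewrite -subr_eq0; apply/eqP/unit_pi.
  have -> : pi ^ (W z - m) = (z ^+ n`! / pi ^ m) / (z ^+ n`! / pi ^ W z).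
    by rewrite expfzDr // -invr_expz; field; rewrite !expfz_neq0 // expf_neq0.
  exact: (vunitM valO Um (vunitV (HW _ z0))).
have WM x y : x != 0 -> y != 0 -> W (x * y) = W x + W y.
  move=> x0 y0; apply: WU; first by rewrite mulf_neq0.
  have -> : (x * y) ^+ n`! / pi ^ (W x + W y) = (x ^+ n`! / pi ^ W x) * (y ^+ n`! / pi ^ W y).
    by rewrite expfzDr // exprMn; field; rewrite !expfz_neq0.
  exact: (vunitM valO (HW _ x0) (HW _ y0)).
have W1 : W 1 = 0.
  have : W (1 * 1) = W 1 + W 1 by apply: WM; exact: oner_neq0.
  by rewrite mulr1; lia.
have WV x : x != 0 -> W x^-1 = - W x.
  by move=> x0; have := WM _ _ x0 (invr_neq0 x0); rewrite divff // W1; lia.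
have WO x : x != 0 -> O x <-> 0 <= W x.
  have H z : z != 0 -> O z -> 0 <= W z.
    move=> z0 Oz; apply/ring_pi; have [_ _ Oi] := HW _ z0.
    have -> : pi ^ W z = z ^+ n`! * (z ^+ n`! / pi ^ W z)^-1.
      by field; rewrite expf_neq0 // expfz_neq0.
    exact/(vringM valO)/Oi/(vringX valO).
  move=> x0; split; first exact: H.
  move=> Wx; have [//|Ox'] := vring_or valO x.
  have := H _ (invr_neq0 x0) Ox'; rewrite WV // => Wx'.
  have Wx0 : W x = 0 by lia.
  have := HW _ x0; rewrite Wx0 expr0z divr1 => /(vunitXV valO).
  by case; rewrite ?fact_gt0.
have Wpi : W pi = n`! by apply: WU => //; rewrite divff ?expf_neq0 //; exact: vunit1 valO.
(* The least positive value is written [d.+1]; one exists because [W pi] is positive. *)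
have ex : exists d : nat, `[< exists2 t, t != 0 & W t = d.+1 >].
  exists n`!.-1; apply/asboolP; exists pi => //.
  by rewrite prednK ?fact_gt0.
have [d /asboolP[t t0 Wt] dmin] := ex_minnP ex.
have WX m : W (t ^+ m) = m%:Z * W t.
  elim: m => [|m IH]; first by rewrite W1 mul0r.
  by rewrite exprS WM ?expf_neq0 // IH; lia.
have WXz (m : int) : W (t ^ m) = m * W t.
  by case: m => m; rewrite ?NegzE -?exprnN ?WV ?expf_neq0 ?WX //; lia.
have Wd z : z != 0 -> W z = (W z %/ d.+1)%Z * d.+1.
  move=> z0; have := divz_eq (W z) d.+1; set q := (_ %/ _)%Z => dq.
  have r0 : 0 <= (W z %% d.+1)%Z by rewrite modz_ge0.
  have rd : (W z %% d.+1)%Z < d.+1 by exact: ltz_pmod.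
  suff r : (W z %% d.+1)%Z = 0 by rewrite dq r addr0.
  have Wr : W (z / t ^ q) = (W z %% d.+1)%Z.
    by rewrite WM ?invr_eq0 ?expfz_neq0 // WV ?expfz_neq0 // WXz Wt {1}dq; lia.
  (* A nonzero remainder would be a positive value below the least one. *)
  case r_: (W z %% d.+1)%Z r0 rd Wr => [[|r]|r] // _ rd Wr.
  have /dmin : `[< exists2 t, t != 0 & W t = r.+1 >].
    by apply/asboolP; exists (z / t ^ q); rewrite // mulf_neq0 ?invr_eq0 ?expfz_neq0.
  lia.
exists (fun z => (W z %/ d.+1)%Z); split.
- move=> x y x0 y0; have xy0 : x * y != 0 by rewrite mulf_neq0.
  have d0 : (d.+1 : int) != 0 by [].
  by apply: (mulIf d0); rewrite mulrDl -!Wd // WM.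
- by move=> x x0; rewrite WO // divz_ge0.
- by exists t => //; rewrite Wt divzz.
Qed.

End Discreteness.

(** * Places of a function field are discrete *)

Section FunctionFieldPlaces.
Variables (F K : fieldType) (i : {rmorphism F -> K}).

(* The relation is the characteristic polynomial of the multiplication by z,
   after clearing the denominators of its matrix. *)
Lemma function_field_relation : function_field i ->
  exists x : K, ~ algebraicOver i x /\ exists n, forall z : K,
  exists g : nat -> {poly F}, (exists k, (k < n.+1)%N /\ g k != 0) /\
    \sum_(k < n.+1) (map_poly i (g k)).[x] * z ^+ k = 0.
Proof.
move=> [x [trx [n [e spanE]]]]; exists x; split=> //; exists n => z.
pose h : {rmorphism {poly F} -> K} := horner_morph (fun c => mulrC x (i c)).
have h0 p : p != 0 -> h p != 0.
  move=> p0; apply/negP => hp; apply: trx; exists p => //.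
have /choice[C HC] : forall j, exists c : 'I_n -> K,
    (forall k, rational_in i x (c k)) /\ z * e j = \sum_(k < n) c k * e k.
  by move=> j; exact: spanE.
have /choice[pq Hpq] : forall jk : 'I_n * 'I_n, exists pq : {poly F} * {poly F},
    h pq.2 != 0 /\ C jk.1 jk.2 = h pq.1 / h pq.2.
  by move=> [j k]; have [p [q [q0 ->]]] := (HC j).1 k; exists (p, q).
pose d := \prod_jk (pq jk).2.
pose r jk := (pq jk).1 * \prod_(l | l != jk) (pq l).2.
have hr jk : h d * C jk.1 jk.2 = h (r jk).
  have [q0 ->] := Hpq jk; rewrite /d (bigD1 jk) //= !rmorphM /=.
  by field.
have d0 : d != 0.
  apply/prodf_neq0 => jk _; have [+ _] := Hpq jk.
  by apply: contra_neq => ->; rewrite rmorph0.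
(* With the indices transposed, the row of the [e j] is a left eigenvector of the image of [A], with
   eigenvalue [h d * z]. *)
pose A : 'M[{poly F}]_n := \matrix_(k, j) r (j, k).
have : eigenvalue (map_mx h A) (h d * z).
  apply/eigenvalueP; exists (\row_j e j).
    apply/rowP => j; rewrite !mxE -mulrA (HC j).2 mulr_sumr.
    by apply: eq_bigr => k _; rewrite !mxE -hr /=; ring.
  apply/negP => /eqP e0; have [c [_ /eqP]] := spanE 1.
  rewrite big1 ?oner_eq0 // => j _.
  by move/rowP: e0 => /(_ j); rewrite !mxE => ->; rewrite mulr0.
rewrite eigenvalue_root_char -map_char_poly => /rootP rt.
(* Substituting [h d * z] into the characteristic polynomial multiplies coefficient [k] by [d ^+ k];
   as the polynomial is monic, the top coefficient is [d ^+ n]. *)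
exists (fun k => (char_poly A)`_k * d ^+ k); split.
  exists n; split=> //; have := char_poly_monic A.
  by rewrite monicE lead_coefE size_char_poly /= => /eqP ->; rewrite mul1r expf_neq0.
rewrite -[RHS]rt (@horner_coef_wide _ n.+1); last by rewrite map_char_poly size_char_poly.
by apply: eq_bigr => k _; rewrite coef_map exprMn mulrA -rmorphXn -rmorphM.
Qed.

Lemma horner_mapD p c x : (map_poly i (p * 'X + c%:P)).[x] = (map_poly i p).[x] * x + i c.
Proof. by rewrite rmorphD rmorphM /= map_polyX map_polyC !hornerE. Qed.

Section Transcendental.
Variables (O : set K) (x : K).
Hypotheses (valO : valuation_ring i O) (trx : ~ algebraicOver i x).
Local Notation h p := ((map_poly i p).[x]).

Let h0 p : p != 0 -> h p != 0.
Proof. by move=> p0; apply/negP => hp; apply: trx; exists p. Qed.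

Let Uc c : c != 0 -> unit_of O (i c).
Proof.
move=> c0; split; rewrite ?fmorph_eq0 -?fmorphV //; exact: (vring_const valO).
Qed.

(** Nonzero constants being units, the leading term dominates at a pole of [x]: the value is that of
    [x] to the degree of [p], whence a negated exponent for [x^-1]. *)
Lemma poly_value_at_pole p : ~ O x -> p != 0 -> exists m : int, unit_of O (h p / x^-1 ^ m).
Proof.
move=> nx; have [x0 Ox nux] := nvringV valO nx.
suff H : p != 0 -> exists m : nat, unit_of O (h p / x ^+ m).
  by move=> /H[m Um]; exists (- m%:Z); rewrite -exprz_inv invrK.
elim/poly_ind: p => [|p c IH]; first by rewrite eqxx.
rewrite horner_mapD; have [->|p0] := eqVneq p 0.
  rewrite mul0r add0r polyC_eq0 => c0; exists 0%N.
  by rewrite rmorph0 horner0 mul0r add0r expr0 divr1; exact: Uc.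
move=> _; have [m Um] := IH p0; exists m.+1.
have -> : (h p * x + i c) / x ^+ m.+1 = h p / x ^+ m + x^-1 * (i c * x^-1 ^+ m).
  by rewrite exprS exprVn; field; rewrite x0 expf_neq0.
have Oc : O (i c * x^-1 ^+ m).
  exact: (vringM valO (vring_const valO c) (vringX valO _ Ox)).
apply: (vunitD valO) => //; first exact: (vringM valO).
by rewrite mulrC; apply: (vnonunitM valO).
Qed.

(** The element [pi] is the value at [x] of a polynomial [q] of least degree among the nonzero ones
    with non-unit value. By minimality, a polynomial with non-unit value has remainder 0 modulo [q],
    so induction on the size strips off the powers of [q]. *)
Lemma poly_value p0 : O x -> p0 != 0 -> ~ unit_of O (h p0) ->
  exists2 pi, pi != 0 & ~ O pi^-1 /\
   forall p, p != 0 -> exists m : int, unit_of O (h p / pi ^ m).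
Proof.
move=> Ox p00 np0.
have Oh p : O (h p).
  elim/poly_ind: p => [|p c IH]; first by rewrite rmorph0 horner0; exact: (vring0 valO).
  by rewrite horner_mapD; apply/(vringD valO)/(vring_const valO)/(vringM valO).
have ex : exists n, `[< exists p, [/\ p != 0, ~ unit_of O (h p) & size p = n] >].
  by exists (size p0); apply/asboolP; exists p0.
have [_ /asboolP[q [q0 nq <-]] qmin] := ex_minnP ex.
exists (h q); first exact: h0.
split; first by move=> Oq; apply: nq; split=> //; exact: h0.
have q1 : (1 < size q)%N.
  rewrite ltnNge; apply/negP => q1; apply: nq.
  move: q0; rewrite (size1_polyC q1) polyC_eq0 map_polyC hornerC => c0; exact: Uc.
move=> p; have [s sp] := ubnP (size p); elim: s p sp => // s IH p sp pn0.
have [Up|nUp] := pselect (unit_of O (h p)); first by exists 0; rewrite expr0z divr1.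
have pE := divp_eq p q.
have r0 : p %% q = 0.
  apply/eqP; apply: contraT => r0.
  suff /qmin : `[< exists p', [/\ p' != 0, ~ unit_of O (h p') & size p' = size (p %% q)] >].
    by rewrite leqNgt ltn_modp q0.
  apply/asboolP; exists (p %% q); split=> //.
  have -> : h (p %% q) = h p + - (h (p %/ q) * h q).
    by rewrite {2}pE rmorphD rmorphM /= hornerD hornerM; ring.
  apply: (vnonunitD valO) => //; first exact/(vringN valO)/(vringM valO).
  by apply: (vnonunitN valO); apply: (vnonunitM valO).
have d0 : p %/ q != 0.
  by apply: contra_neq pn0 => d0; rewrite pE d0 r0 mul0r addr0.
have [|m Um] := IH (p %/ q) _ d0.
  apply: leq_trans (_ : size p <= s)%N => //.
  rewrite size_divp // -subn1; have : (0 < size p)%N by rewrite size_poly_gt0.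
  by move: q1; case: (size q) => [|[|k]] //; case: (size p) => //; lia.
exists (m + 1); rewrite expfzDr ?h0 // expr1z {1}pE r0 addr0 rmorphM hornerM.
have -> : h (p %/ q) * h q / (h q ^ m * h q) = h (p %/ q) / h q ^ m.
  by field; rewrite expfz_neq0 h0.
by [].
Qed.

End Transcendental.

(** The relations have polynomials in [x] as coefficients, so [exists_normalized_valuation] applies
    once these have the values of powers of one element: [x^-1] at a pole of [x], and a polynomial
    in [x] otherwise. *)
Lemma place_discrete (P : place i) : function_field i ->
  exists V, normalized_valuation (place_ring P) V.
Proof.
move=> /function_field_relation[x [trx [n rel]]].
have valP := place_ringP P; set O := place_ring P in valP *.
have h0 p : p != 0 -> (map_poly i p).[x] != 0.
  by move=> p0; apply/negP => hp; apply: trx; exists p.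
suff [pi pi0 [npi pival]] : exists2 pi, pi != 0 & ~ O pi^-1 /\
   forall p, p != 0 -> exists m : int, unit_of O ((map_poly i p).[x] / pi ^ m).
  apply: (exists_normalized_valuation valP (pi := pi) (n := n)
    (C := [set (map_poly i p).[x] | p in [set: {poly F}]]%classic)) => //.
    move=> _ [p _ <-] hp; apply: pival; apply: contra_neq hp => ->.
    by rewrite rmorph0 horner0.
  move=> z z0; have [g [[k [kn gk]] S0]] := rel z.
  exists (fun k => (map_poly i (g k)).[x]); split; [by move=> j; exists (g j) | | by []].
  by exists k; split=> //; exact: h0.
have [Ox|nOx] := pselect (O x); last first.
  have [x0 Ox nux] := nvringV valP nOx.
  exists x^-1; rewrite ?invr_eq0 ?invrK //; split=> // p p0.
  exact: poly_value_at_pole.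
suff [p p0 np] : exists2 p, p != 0 & ~ unit_of O (map_poly i p).[x].
  exact: (poly_value valP trx Ox p0 np).
(* If all nonzero polynomials had unit values, the relation of an element [z] outside the ring would
   make a power of [z], hence [z] itself, a unit. *)
apply: contrapT => allU; have [z nz] := vring_proper valP.
have [z0 Oz nuz] := nvringV valP nz.
have [g [[k [kn gk]] S0]] := rel z.
have U p : p != 0 -> unit_of O (map_poly i p).[x].
  by move=> p0; apply: contrapT => np; apply: allU; exists p.
have [||j [l [jl ln gj gl Uz]]] :=
    @relation_value _ _ _ _ valP n.+1 (fun k => (map_poly i (g k)).[x]) z z0.
- by exists k; split=> //; exact: h0.
- exact: S0.
have nz0 p : (map_poly i p).[x] != 0 -> p != 0.
  by apply: contra_neq => ->; rewrite rmorph0 horner0.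
have : unit_of O (z ^+ (l - j)).
  have -> : z ^+ (l - j) = (z ^+ (l - j) * ((map_poly i (g l)).[x] / (map_poly i (g j)).[x]))
     * ((map_poly i (g j)).[x] / (map_poly i (g l)).[x]).
    by field; rewrite gj gl.
  apply: (vunitM valP) => //; apply: (vunitM valP); first exact/U/nz0.
  exact/vunitV/U/nz0.
by move/(vunitXV valP); rewrite subn_gt0 => /(_ jl)[].
Qed.

End FunctionFieldPlaces.

(** * Linear algebra of a cubic extension and its generators *)

Section CubicExtension.
Variables (K : fieldType) (L : fieldExtType K).
Local Notation iota := (in_alg L).

Lemma dim_relation n (b : nat -> L) : \dim {:L} = n ->
  exists c : nat -> K, (exists k, (k < n.+1)%N /\ c k != 0) /\
    \sum_(k < n.+1) iota (c k) * b k = 0.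
Proof.
move=> dimL; pose X := [tuple b k | k < n.+1].
have /freeP : ~~ free X.
  rewrite /free size_tuple; apply/negP => /eqP dX.
  by have := dimvS (subvf <<X>>%VS); rewrite dX dimL ltnn.
move/existsNP => [c /not_implyP[S0 /existsNP[k ck]]].
exists (fun j => c (inord j)); split.
  by exists k; rewrite inord_val; split=> //; exact/eqP.
rewrite -[RHS]S0; apply: eq_bigr => j _.
by rewrite inord_val -tnth_nth tnth_mktuple mulr_algl.
Qed.

Lemma horner_cubic (z : L) (c : K) :
  (map_poly iota ('X^3 + c *: 'X + (c ^+ 2)%:P)).[z] = z ^+ 3 + iota c * z + iota c ^+ 2.
Proof.
rewrite !rmorphD /= map_polyXn map_polyZ /= map_polyX map_polyC /= !hornerE.
by congr (_ + _); rewrite -[LHS]/(iota (c ^+ 2)) rmorphXn.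
Qed.

Lemma size_cubic (c : K) : size ('X^3 + c *: 'X + (c ^+ 2)%:P) = 4%N.
Proof.
rewrite -addrA size_polyDl size_polyXn //.
apply: leq_ltn_trans (size_polyD _ _) _; rewrite gtn_max.
rewrite (leq_ltn_trans (size_scale_leq _ _)) ?size_polyX //.
exact: leq_ltn_trans (size_polyC_leq1 _) _.
Qed.

Lemma generator_root (z : L) (c : K) : generator_with_minpoly z c ->
  z ^+ 3 + iota c * z + iota c ^+ 2 = 0.
Proof.
move=> [_ mE]; have := root_minPoly 1%AS z; rewrite mE => /rootP.
by rewrite horner_cubic.
Qed.

Lemma generator_coords (z : L) (c : K) : generator_with_minpoly z c -> forall x,
  exists u : K * K * K, x = iota u.1.1 + iota u.1.2 * z + iota u.2 * z ^+ 2.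
Proof.
move=> [gen mE] x; have xz : x \in <<1; z>>%VS by rewrite gen memvf.
have := Fadjoin_polyOver 1 z x; have := Fadjoin_poly_eq xz.
have := size_Fadjoin_poly 1 z x; set p := Fadjoin_poly _ _ _.
have := size_minPoly 1 z; rewrite mE size_map_poly => sz.
have -> : adjoin_degree 1 z = 3%N.
  by apply: succn_inj; rewrite -sz size_cubic.
move=> sp px /polyOver1P[q pE].
exists (q`_0, q`_1, q`_2) => /=; rewrite -{1}px (horner_coef_wide _ sp) pE.
by rewrite !big_ord_recl big_ord0 /= !coef_map /= expr0 expr1; ring.
Qed.

(** A nontrivial relation would be a nonzero polynomial vanishing at [z], of smaller degree than the
    minimal polynomial. *)
Lemma generator_free (z : L) (c : K) : generator_with_minpoly z c -> forall u0 u1 u2 : K,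
  iota u0 + iota u1 * z + iota u2 * z ^+ 2 = 0 -> [/\ u0 = 0, u1 = 0 & u2 = 0].
Proof.
move=> [gen mE] u0 u1 u2 uz; pose q : {poly K} := Poly [:: u0; u1; u2].
have q0 : map_poly iota q = 0.
  apply/eqP; apply: contraT => q0.
  have qK : map_poly iota q \is a polyOver 1%AS by apply/polyOver1P; exists q.
  have /(minPoly_dvdp qK)/dvdp_leq : root (map_poly iota q) z.
    apply/rootP; rewrite (@horner_coef_wide _ 3); last first.
      by rewrite size_map_poly; exact: size_Poly.
    rewrite !big_ord_recl big_ord0 !coef_map !coef_Poly -[RHS]uz.
    by rewrite expr0 expr1; ring.
  by rewrite mE !size_map_poly size_cubic ltnNge (size_Poly [:: u0; u1; u2]) => /(_ q0).
have {}q0 : q = 0 by apply/eqP; rewrite -(map_poly_eq0 iota) q0.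
by split; [have := coef_Poly [:: u0; u1; u2] 0 | have := coef_Poly [:: u0; u1; u2] 1
  | have := coef_Poly [:: u0; u1; u2] 2]; rewrite -/q q0 coef0.
Qed.

(** The degree 3 is prime, so an element outside the base field generates [L]. Its minimal
    polynomial then has degree 3 and divides the given monic cubic. *)
Lemma cubic_generator (z : L) (c : K) : \dim {:L} = 3%N -> z \notin 1%VS ->
  z ^+ 3 + iota c * z + iota c ^+ 2 = 0 -> generator_with_minpoly z c.
Proof.
move=> dimL z1 rz.
have gen : <<1; z>>%VS = {:L}%VS.
  apply/eqP; rewrite eqEdim subvf dimL /=.
  have := field_dimS (subvf <<1; z>>%AS); rewrite dimL /= => d3.
  have d1 : \dim <<1; z>>%VS != 1%N.
    apply: contra z1 => /eqP d1.
    have /eqP -> : 1%VS == <<1; z>>%VS by rewrite eqEdim sub1v /= d1 dimv1.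
    exact: memv_adjoin.
  have : \dim <<1; z>>%VS \in divisors 3 by rewrite -dvdn_divisors.
  by rewrite !inE (negPf d1) /= => /eqP ->.
split=> //.
set q := 'X^3 + _ + _.
have q3 : size q = 4%N.
  exact: size_cubic.
have qm : q \is monic.
  rewrite monicE lead_coefE q3 /= /q !coefD coefXn coefZ coefX coefC /=.
  by rewrite mulr0 !addr0.
have m4 : size (minPoly 1 z) = 4%N.
  by rewrite size_minPoly; have := dim_Fadjoin 1%AS z; rewrite gen dimL dimv1 muln1 => <-.
apply/eqP; rewrite -eqp_monic ?monic_minPoly ?map_monic //.
rewrite -dvdp_size_eqp; last first.
  apply: minPoly_dvdp; first by apply/polyOver1P; exists q.
  by apply/rootP; rewrite horner_cubic.
by rewrite m4 size_map_poly q3.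
Qed.

End CubicExtension.

(** * The valuation above a fully ramified place *)

Section FullyRamified.
Variables (F K : fieldType) (i : F -> K) (L : fieldExtType K).
Variables (P : place i) (v : K -> int).
Local Notation iota := (in_alg L).
Hypothesis nvP : normalized_valuation (place_ring P) v.

Lemma in_algXz (x : K) (n : int) : iota (x ^ n) = iota x ^ n.
Proof. by case: n => n; rewrite ?NegzE -?exprnN ?fmorphV rmorphXn. Qed.

(** The default of [pval] is 0, so any other result comes from a true factorization, even before the
    place is known to be discrete. *)
Lemma pval_neq0 (E : fieldType) (j : F -> E) (Q : place j) (z : E) :
  pval Q z <> 0 -> exists t u,
    [/\ uniformizer Q t, unit_of (place_ring Q) u & z = t ^ pval Q z * u].
Proof.
move=> pz; apply: contrapT => nex; apply: pz; apply: xgetPN => n [t [u tu]].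
have ex : exists m, [set n : int | exists t u : E,
    [/\ uniformizer Q t, unit_of (place_ring Q) u & z = t ^ n * u]]%classic m.
  by exists n, t, u.
by have [t' [u' tu']] := xgetPex (0 : int) ex; apply: nex; exists t', u'.
Qed.

(** Nonzero results of [pval] provide uniformizers of [Q]. With them, units at [P] are seen to
    remain units at [Q]; hence elements of the base field have the values of powers of [iota t], and
    relations of degree at most 3 make [Q] discrete. *)
Lemma fully_ramified_valuation : \dim {:L} = 3%N -> fully_ramified L P ->
  exists (Q : place (ext_const i L)) (V : L -> int),
    normalized_valuation (place_ring Q) V /\
    forall x, x != 0 -> V (iota x) = 3 * v x.
Proof.
move=> dimL [Q [above indexQ]]; have valQ := place_ringP Q.
have HE x : x != 0 -> pval Q (iota x) = 3 * v x.
  move=> x0; rewrite -(pvalE nvP x0); apply: contrapT => nx.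
  (* If no index had the required property, the default 0 would be returned, against the value 3. *)
  have ri0 : ramification_index Q P = 0%N.
    apply: xgetPN => e He; apply: nx.
    have ex : exists e', [set e : nat |
        forall x : K, x != 0 -> pval Q x%:A = e%:Z * pval P x]%classic e' by exists e.
    by have := xgetPex 0%N ex; rewrite -/(ramification_index Q P) indexQ; apply.
  by move: indexQ; rewrite ri0.
have [t t0 vt] := nv_uniformizer nvP.
have it0 : iota t != 0 by rewrite fmorph_eq0.
have unifQ s s' : s != 0 -> s' != 0 -> uniformizer Q s -> uniformizer Q s' ->
    unit_of (place_ring Q) (s / s').
  have H s1 s2 : s1 != 0 -> s2 != 0 -> uniformizer Q s1 -> uniformizer Q s2 ->
      place_ring Q (s1 / s2).
    move=> s10 s20 u1 u2; have : place_ideal Q s1.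
      by rewrite u1; exists 1; rewrite ?mulr1 //; exact: (vring1 valQ).
    by rewrite u2 => -[x Ox <-]; rewrite mulrC mulKf.
  move=> s0 s'0 us us'; split; first exact: H.
    by rewrite mulf_neq0 ?invr_eq0.
  by rewrite invf_div; exact: H.
(* Both [t] and [t * u] have [pval] 3 at [Q], so each is the cube of a uniformizer times a unit, and
   [u] is their quotient. *)
have unitQ u : unit_of (place_ring P) u -> unit_of (place_ring Q) (iota u).
  move=> /(nv_unit nvP)[u0 vu]; have tu0 : t * u != 0 by rewrite mulf_neq0.
  have e1 : pval Q (iota t) = 3 by rewrite HE // vt.
  have e2 : pval Q (iota (t * u)) = 3 by rewrite HE // (nvM nvP) // vt vu.
  have [|s1 [w1 [us1 Uw1]]] := @pval_neq0 _ _ Q (iota t); first by rewrite e1.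
  rewrite e1 => t1.
  have [|s2 [w2 [us2 Uw2]]] := @pval_neq0 _ _ Q (iota (t * u)); first by rewrite e2.
  rewrite e2 => t2.
  have s10 : s1 != 0 by move: it0; apply: contra_neq => s1z; rewrite t1 s1z exp0rz mul0r.
  have w10 : w1 != 0 by case: Uw1.
  have s20 : s2 != 0.
    have : iota (t * u) != 0 by rewrite fmorph_eq0.
    by apply: contra_neq => s2z; rewrite t2 s2z exp0rz mul0r.
  have -> : iota u = (s2 / s1) ^+ 3 * (w2 / w1).
    have -> : iota u = iota (t * u) / iota t by rewrite rmorphM /= mulrAC divff // mul1r.
    by rewrite t2 t1; field; rewrite s10 w10.
  apply: (vunitM valQ); first by apply/(vunitX valQ)/unifQ.
  exact: (vunitM valQ Uw2 (vunitV Uw1)).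
have [V nvQ] : exists V, normalized_valuation (place_ring Q) V.
  apply: (exists_normalized_valuation valQ (pi := iota t) (n := 3) (C := range iota)) => //.
  - have [Ot nt] : place_ideal Q (iota t) by apply/above/(place_idealP nvP); right; rewrite vt.
    by move=> Oi; apply: nt.
  - move=> _ [x _ <-]; rewrite fmorph_eq0 => x0; exists (v x).
    rewrite -in_algXz -fmorph_div; apply: unitQ; apply/(nv_unit nvP).
    rewrite mulf_neq0 ?invr_eq0 ?expfz_neq0 //.
    by rewrite (nvM nvP) ?(nvV nvP) ?(nvXz nvP) ?invr_eq0 ?expfz_neq0 // vt; split=> //; lia.
  - move=> z _; have [c [[k [kn ck]] S0]] := dim_relation (fun k => z ^+ k) dimL.
    exists (fun k => iota (c k)); split; [by move=> j; exists (c j) | | exact: S0].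
    by exists k; rewrite fmorph_eq0.
by exists Q, V; split=> // x x0; rewrite -(pvalE nvQ) ?fmorph_eq0 // HE.
Qed.

End FullyRamified.

(** * Approximation of a generator by elements of the base field *)

Section Approximation.
Variables (F K L : fieldType) (iota : {rmorphism K -> L}) (i : F -> L) (O : set L).
Variables (v : K -> int) (V : L -> int).
Hypotheses (valO : valuation_ring i O) (nv : normalized_valuation O V).
Hypotheses (Viota : forall x, x != 0 -> V (iota x) = 3 * v x).
Hypotheses (v_surj : forall n : int, exists2 t, t != 0 & v t = n).
Hypothesis dim_le3 : forall b : nat -> L, exists c : nat -> K,
  (exists k, (k < 4)%N /\ c k != 0) /\ \sum_(k < 4) iota (c k) * b k = 0.

(* As e = 3 = [L : K], the residue degree is 1: otherwise 1, t, t^2, u would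
   be linearly independent, for t a uniformizer. *)
Lemma residue_degree1 u : u != 0 -> V u = 0 -> exists k, vge V 1 (u - iota k).
Proof.
move=> u0 Vu; apply: contrapT => /forallNP nk.
(* Under the contrary assumption the value of [u - iota k] is at most 0: either it is 0, or it is
   negative and equals that of [iota k]. *)
have Vku k : u - iota k != 0 /\ exists m, V (u - iota k) = 3 * m.
  have nz : u - iota k != 0 by apply/eqP => e; apply: (nk k); left.
  split=> //; have Vle : V (u - iota k) <= 0.
    by rewrite leNgt; apply/negP => Vgt; apply: (nk k); right; lia.
  have [->|k0] := eqVneq k 0; first by exists 0; rewrite rmorph0 subr0 Vu.
  have [e|ne] := eqVneq (V (u - iota k)) 0; first by exists 0; rewrite e.
  exists (v k); rewrite -Viota //.
  have [||_ e] := @nv_dominant _ _ _ _ _ valO nv (u - iota k) (- u) => //.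
    by right; rewrite (nvN nv) Vu; lia.
  by rewrite -e addrAC subrr sub0r (nvN nv).
have [t t0 Vt] := nv_uniformizer nv.
pose b k := nth 0 [:: 1; t; t ^+ 2; u] k.
have [c [[k0 [k0n ck0]] S0]] := dim_le3 b.
(* The terms with 1 and [u] are merged. The nonzero ones among the three resulting terms have values
   congruent to 0, 1 and 2 modulo 3, so their sum cannot vanish. *)
pose b' k := nth 0 [:: iota (c 0%N) + iota (c 3) * u; iota (c 1%N) * t; iota (c 2) * t ^+ 2] k.
have S' : \sum_(k < 3) b' k = 0.
  by rewrite -[RHS]S0 /b /b' !big_ord_recl !big_ord0 /=; ring.
have b'0 : (c 0%N != 0) || (c 3 != 0) -> b' 0%N != 0 /\ exists m, V (b' 0%N) = 3 * m.
  rewrite /b' /=; have [->|c3] /= := eqVneq (c 3) 0.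
    rewrite orbF rmorph0 mul0r addr0 => c0.
    by rewrite fmorph_eq0; split=> //; exists (v (c 0%N)); rewrite Viota.
  move=> _; have [nz [m Vm]] := Vku (- (c 0%N / c 3)).
  have -> : iota (c 0%N) + iota (c 3) * u = iota (c 3) * (u - iota (- (c 0%N / c 3))).
    by rewrite rmorphN fmorph_div /=; field; rewrite fmorph_eq0.
  rewrite mulf_neq0 ?fmorph_eq0 //; split=> //.
  by exists (v (c 3) + m); rewrite (nvM nv) ?fmorph_eq0 // Viota // Vm; lia.
have b0P : b' 0%N != 0 -> exists m, V (b' 0%N) = 3 * m.
  move=> nz; have [] := b'0; last by [].
  apply: contraNT nz; rewrite negb_or !negbK => /andP[/eqP c0 /eqP c3].
  by rewrite /b' /= c0 c3 !rmorph0 mul0r addr0.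
have b1P : b' 1%N != 0 -> exists m, V (b' 1%N) = 3 * m + 1.
  rewrite /b' /= mulf_eq0 fmorph_eq0 negb_or => /andP[c0 _].
  by exists (v (c 1%N)); rewrite (nvM nv) ?fmorph_eq0 // Viota // Vt.
have b2P : b' 2 != 0 -> exists m, V (b' 2) = 3 * m + 2.
  rewrite /b' /= mulf_eq0 fmorph_eq0 negb_or => /andP[c0 _].
  by exists (v (c 2)); rewrite (nvM nv) ?expf_neq0 ?fmorph_eq0 // Viota // (nvX nv) // Vt.
have [||k [_ _ + _ _]] := @nv_sum_dominant _ _ _ _ _ valO nv 3 b'; last by rewrite S' eqxx.
  have [/orP|] := boolP ((c 0%N != 0) || (c 3 != 0)).
    by move=> /orP/b'0[nz _]; exists 0%N.
  rewrite negb_or !negbK => /andP[/eqP c0 /eqP c3].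
  case: k0 k0n ck0 => [|[|[|[|//]]]] _; rewrite ?c0 ?c3 ?eqxx // => ck.
    by exists 1%N; split=> //; rewrite /b' /= mulf_neq0 ?fmorph_eq0.
  by exists 2; split=> //; rewrite /b' /= mulf_neq0 ?fmorph_eq0 ?expf_neq0.
move=> j [|[|[|//]]]; case: j => [|[|//]] // _ _.
- by move=> /b0P[m ->] /b1P[m' ->]; lia.
- by move=> /b0P[m ->] /b2P[m' ->]; lia.
- by move=> /b1P[m ->] /b2P[m' ->]; lia.
Qed.

(** Otherwise elements [w] of the base field approximate [y] arbitrarily well. A uniformizer is a
    quadratic polynomial in [y]; at a good [w] this polynomial takes a result in the base field that
    still has value 1, although 3 does not divide 1. *)
Lemma exists_val_coprime3 y :
  (forall x, exists u : K * K * K, x = iota u.1.1 + iota u.1.2 * y + iota u.2 * y ^+ 2) ->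
  exists w, y - iota w != 0 /\ forall m, V (y - iota w) <> 3 * m.
Proof.
move=> coords; apply: contrapT => /forallNP nw.
have Vw w : y - iota w != 0 -> exists m, V (y - iota w) = 3 * m.
  by move=> nz; apply: contrapT => nm; apply: (nw w); split=> // m e; apply: nm; exists m.
(* Each step divides [y - iota w] by an element of the base field of the same value and subtracts
   the residue, which raises the value by at least 1. *)
have approx (n : nat) : exists w, vge V (V y + n%:Z) (y - iota w).
  elim: n => [|n [w gw]].
    by exists 0; rewrite (_ : y - iota 0 = y) ?rmorph0 ?subr0 //; right; lia.
  have [e|nz] := eqVneq (y - iota w) 0; first by exists w; left.
  have [m Vm] := Vw _ nz; have [t t0 vt] := v_surj m.
  have it0 : iota t != 0 by rewrite fmorph_eq0.
  have [||k gk] := residue_degree1 (u := (y - iota w) / iota t).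
  - by rewrite mulf_neq0 ?invr_eq0.
  - by rewrite (nvM nv) ?invr_eq0 // (nvV nv) // Viota // vt Vm subrr.
  exists (w + t * k).
  have -> : y - iota (w + t * k) = iota t * ((y - iota w) / iota t - iota k).
    by rewrite rmorphD rmorphM /=; field.
  case: gw => [/eqP|gw]; first by rewrite (negPf nz).
  apply: vge_le (vgeM nv (vge_refl V (iota t)) gk).
  by rewrite Viota // vt; lia.
have [t t0 Vt] := nv_uniformizer nv; have [[[c0 c1] c2] /= tE] := coords t.
pose B := V (iota c1 + 2 * iota c2 * y); pose C := V (iota c2).
(* The first summand cancels the initial value [V y], the next two absorb the coefficients in the
   second factor below, and 2 exceeds [V t = 1]. *)
have [w gw] := approx (`|V y| + `|B| + `|C| + 2)%N.
have gt2 : vge V (V t + 1) (- (t - iota (c0 + c1 * w + c2 * w ^+ 2))).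
  apply: (vgeN nv).
  (* Taylor expansion of the quadratic polynomial around [y]. *)
  have -> : t - iota (c0 + c1 * w + c2 * w ^+ 2) =
      (y - iota w) * ((iota c1 + 2 * iota c2 * y) - iota c2 * (y - iota w)).
    by rewrite tE !rmorphD !rmorphM /=; ring.
  have gN : vge V (`|B|%N%:Z + `|C|%N%:Z + 2) (y - iota w) by apply: vge_le gw; lia.
  apply: vge_le (vgeM nv gN (_ : vge V (- `|B|%N%:Z - `|C|%N%:Z) _)); first by rewrite Vt; lia.
  apply: (vgeB valO nv); first by apply: vge_le (vge_refl V _); rewrite -/B; lia.
  by apply: vge_le (vgeM nv (vge_refl V (iota c2)) gN); rewrite -/C; lia.
have [nz] := nv_dominant valO nv t0 gt2.
rewrite opprB addrC subrK; set g := _ + _ + _.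
rewrite Vt; have g0 : g != 0.
  by move: nz; rewrite opprB addrC subrK fmorph_eq0.
by rewrite Viota //; lia.
Qed.

End Approximation.

(** * The norm form of a cubic generator and its values *)

(* The norm of u0 + u1 z + u2 z^2, where z^3 + c z + c^2 = 0. *)
Definition cubic_norm (K : fieldType) (c : K) (u : K * K * K) : K :=
  u.1.1 ^+ 3 - c ^+ 2 * u.1.2 ^+ 3 + c ^+ 4 * u.2 ^+ 3
  + (- 2 * c * u.1.1 ^+ 2 * u.2 + c ^+ 2 * u.1.1 * u.2 ^+ 2 + c * u.1.1 * u.1.2 ^+ 2
     + 3 * c ^+ 2 * u.1.1 * u.1.2 * u.2 - c ^+ 3 * u.1.2 * u.2 ^+ 2).

(** Coordinates in the basis 1, z, z^2, with products reduced by z^3 = - c z - c^2. *)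
Definition cubic_mul (K : fieldType) (c : K) (u w : K * K * K) : K * K * K :=
  (u.1.1 * w.1.1 - c ^+ 2 * (u.1.2 * w.2 + u.2 * w.1.2),
   u.1.1 * w.1.2 + u.1.2 * w.1.1 - c * (u.1.2 * w.2 + u.2 * w.1.2) - c ^+ 2 * u.2 * w.2,
   u.1.1 * w.2 + u.1.2 * w.1.2 + u.2 * w.1.1 - c * u.2 * w.2).

Lemma cubic_normM (K : fieldType) (c : K) u w :
  cubic_norm c (cubic_mul c u w) = cubic_norm c u * cubic_norm c w.
Proof.
case: u => [[u0 u1] u2]; case: w => [[w0 w1] w2].
by rewrite /cubic_norm /cubic_mul /=; ring.
Qed.

Section CubicNorm.
Variables (F K : fieldType) (i : F -> K) (O : set K) (v : K -> int) (c : K) (m : int).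
Hypotheses (valO : valuation_ring i O) (nv : normalized_valuation O v).
Hypotheses (char3 : 3%:R = 0 :> K) (c0 : c != 0) (vc : v c = - m) (m0 : 0 < m).
Hypothesis m3 : forall k, m <> 3 * k.
Local Notation "n <=v x" := (vge v n x) (at level 70).

(* Every mixed term of the norm is, up to a positive power of c, below a
   weighted geometric mean of the pure cubic terms. *)
Lemma cubic_norm_mixed n u0 u1 u2 :
  n <=v u0 ^+ 3 -> n <=v c ^+ 2 * u1 ^+ 3 -> n <=v c ^+ 4 * u2 ^+ 3 ->
  n + 1 <=v - 2 * c * u0 ^+ 2 * u2 + c ^+ 2 * u0 * u2 ^+ 2 + c * u0 * u1 ^+ 2
     + 3 * c ^+ 2 * u0 * u1 * u2 - c ^+ 3 * u1 * u2 ^+ 2.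
Proof.
have N2 : - 2 = 1 :> K by rewrite -[RHS]subr0 -char3; ring.
rewrite N2 char3 !mul1r !mul0r addr0.
have nz (x y : K) : n <=v x * y -> x != 0 -> y != 0 -> n <= v x + v y.
  move=> [/eqP|] + x0 y0; first by rewrite mulf_eq0 (negPf x0) (negPf y0).
  by rewrite (nvM nv).
have H0 : n <=v u0 ^+ 3 -> u0 != 0 -> n <= 3 * v u0.
  move=> [/eqP|] + u00; first by rewrite expf_eq0 (negPf u00).
  by rewrite (nvX nv).
move=> /H0 h0 h1 h2.
have {}h1 : u1 != 0 -> n <= 3 * v u1 - 2 * m.
  by move=> u10; have := nz _ _ h1; rewrite !expf_neq0 // !(nvX nv) // vc => /(_ isT isT); lia.
have {}h2 : u2 != 0 -> n <= 3 * v u2 - 4 * m.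
  by move=> u20; have := nz _ _ h2; rewrite !expf_neq0 // !(nvX nv) // vc => /(_ isT isT); lia.
have T (a : nat) x y : (x != 0 -> y != 0 -> n + 1 <= - m * a%:Z + v x + v y * 2) ->
    n + 1 <=v c ^+ a * x * y ^+ 2.
  move=> H; have [->|x0] := eqVneq x 0; first by rewrite mulr0 mul0r; left.
  have [->|y0] := eqVneq y 0; first by rewrite expr0n mulr0; left.
  right; apply: le_trans (H x0 y0) _.
  by rewrite !(nvM nv) ?mulf_neq0 ?expf_neq0 // !(nvX nv) // vc; lia.
(* The weighted means of the bounds give [n + 2 m / 3] for the term in [u0 * u2 ^+ 2] and
   [n + m / 3] for the other three; as [m] is positive, integrality yields [n + 1]. *)
apply: (vgeB valO nv); first (apply: (vgeD valO nv); first apply: (vgeD valO nv)).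
- rewrite mulrAC -[c]expr1; apply: T => u20 u00.
  by have := h0 u00; have := h2 u20; lia.
- by apply: T => u00 u20; have := h0 u00; have := h2 u20; lia.
- by rewrite -[c]expr1; apply: T => u00 u10; have := h0 u00; have := h1 u10; lia.
- by apply: T => u10 u20; have := h1 u10; have := h2 u20; lia.
Qed.

(** The nonzero pure terms have values [3 v(u0)], [3 v(u1) - 2 m] and [3 v(u2) - 4 m], distinct
    modulo 3 as [m] is prime to 3. The least of them is the value of their sum and, by
    [cubic_norm_mixed], of the norm. *)
Lemma cubic_norm_ring u :
  O (cubic_norm c u) <-> [/\ 0 <=v u.1.1 ^+ 3, 0 <=v c ^+ 2 * u.1.2 ^+ 3
    & 0 <=v c ^+ 4 * u.2 ^+ 3].
Proof.
case: u => [[u0 u1] u2]; rewrite /cubic_norm /=.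
pose b k := nth 0 [:: u0 ^+ 3; - (c ^+ 2 * u1 ^+ 3); c ^+ 4 * u2 ^+ 3] k.
have Sb : \sum_(k < 3) b k = u0 ^+ 3 - c ^+ 2 * u1 ^+ 3 + c ^+ 4 * u2 ^+ 3.
  by rewrite !big_ord_recl big_ord0 /b /=; ring.
split=> [Onorm|[g0 g1 g2]]; last first.
  apply/(vge_ring valO nv); apply: (vgeD valO nv).
    by apply: (vgeD valO nv) => //; apply: (vgeB valO nv).
  by apply: (@vge_le _ _ 0 (0 + 1)) => //; exact: cubic_norm_mixed.
have b0 : b 0%N != 0 -> v (b 0%N) = 3 * v u0.
  by rewrite /b /= expf_eq0 /= => u00; rewrite (nvX nv).
have b1 : b 1%N != 0 -> v (b 1%N) = 3 * v u1 - 2 * m.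
  rewrite /b /= oppr_eq0 mulf_eq0 !expf_eq0 /= (negPf c0) /= => u10.
  by rewrite (nvN nv) (nvM nv) ?expf_neq0 // !(nvX nv) // vc; lia.
have b2 : b 2 != 0 -> v (b 2) = 3 * v u2 - 4 * m.
  rewrite /b /= mulf_eq0 !expf_eq0 /= (negPf c0) /= => u20.
  by rewrite (nvM nv) ?expf_neq0 // !(nvX nv) // vc; lia.
have [ex|nex] := pselect (exists k, (k < 3)%N /\ b k != 0); last first.
  have bz k : (k < 3)%N -> b k = 0.
    by move=> k3; apply/eqP; apply: contrapT => /negP bk; apply: nex; exists k.
  split; left; [exact: (bz 0%N) | | exact: (bz 2)].
  by apply/eqP; rewrite -oppr_eq0; apply/eqP/(bz 1%N).
have [|k [kn bk Snz VS dom]] := nv_sum_dominant valO nv ex.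
  move=> j k; case: k => [|[|[|//]]]; case: j => [|[|//]] // _ _.
  - by move=> /b0-> /b1->; have := @m3 (v u0 - v u1 + m); lia.
  - by move=> /b0-> /b2->; have := @m3 (v u2 - v u0 - m); lia.
  - by move=> /b1-> /b2->; have := @m3 (v u1 - v u2 + m); lia.
have g1 n : n <=v b 1%N -> n <=v c ^+ 2 * u1 ^+ 3.
  by move=> /(vgeN nv); rewrite /b /= opprK.
have mixed := cubic_norm_mixed (dom 0%N isT) (g1 _ (dom 1%N isT)) (dom 2 isT).
rewrite -VS in mixed; have [nz Vnorm] := nv_dominant valO nv Snz mixed.
have V0 : 0 <= v (b k).
  by rewrite -VS -Vnorm -(nvO nv) // Sb.
split; [exact: vge_le V0 (dom 0%N isT) | | exact: vge_le V0 (dom 2 isT)].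
exact: vge_le V0 (g1 _ (dom 1%N isT)).
Qed.

End CubicNorm.

(** * Construction of the fully ramified place from a generator *)

Section EisensteinPlace.
Variables (F K : fieldType) (i : {rmorphism F -> K}) (L : fieldExtType K).
Variables (P : place i) (v : K -> int) (z : L) (c : K).
Hypotheses (nv : normalized_valuation (place_ring P) v) (char3 : 3%:R = 0 :> K).
Hypotheses (gen : generator_with_minpoly z c).
Hypotheses (c0 : c != 0) (vc0 : v c < 0) (vc3 : forall k, v c <> 3 * k).

Lemma eisenstein_fully_ramified : fully_ramified L P.
Proof.
have valP := place_ringP P.
have [iota iotaE] : exists io : {rmorphism K -> L}, forall k, io k = k%:A.
  by exists (in_alg L).
have [co coE'] := choice (generator_coords gen).
have coE x : x = iota (co x).1.1 + iota (co x).1.2 * z + iota (co x).2 * z ^+ 2.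
  by rewrite !iotaE; exact: coE'.
have free u0 u1 u2 : iota u0 + iota u1 * z + iota u2 * z ^+ 2 = 0 ->
    [/\ u0 = 0, u1 = 0 & u2 = 0].
  by rewrite !iotaE; exact: (generator_free gen).
have co_uniq x u : x = iota u.1.1 + iota u.1.2 * z + iota u.2 * z ^+ 2 -> co x = u.
  move=> xE; have := free ((co x).1.1 - u.1.1)
    ((co x).1.2 - u.1.2) ((co x).2 - u.2).
  rewrite !rmorphB => /(_ _)[|/subr0_eq e0 /subr0_eq e1 /subr0_eq e2].
    have /eqP := coE x; rewrite {1}xE eq_sym -subr_eq0 => /eqP <-; ring.
  by rewrite [co x]surjective_pairing [(co x).1]surjective_pairing e0 e1 e2 -!surjective_pairing.
have rz : z ^+ 3 + iota c * z + iota c ^+ 2 = 0.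
  by rewrite iotaE; exact: generator_root gen.
have z3 : z ^+ 3 = - (iota c * z + iota c ^+ 2).
  by apply/eqP; rewrite -subr_eq0 opprK addrA rz.
have coM x y : co (x * y) = cubic_mul c (co x) (co y).
  apply: co_uniq; rewrite {1}(coE x) {1}(coE y) /cubic_mul /=.
  rewrite !(rmorphD, rmorphN, rmorphM, rmorphXn).
  move: (co x).1.1 (co x).1.2 (co x).2 (co y).1.1 (co y).1.2 (co y).2 => x0 x1 x2 y0 y1 y2.
  have z4 : z ^+ 4 = - (iota c * z + iota c ^+ 2) * z by rewrite -z3 exprSr.
  move: (iota x0) (iota x1) (iota x2) (iota y0) (iota y1) (iota y2) (iota c) z3 z4.
  move=> X0 X1 X2 Y0 Y1 Y2 C z3 z4.
  transitivity (X0 * Y0 + (X0 * Y1 + X1 * Y0) * z + (X0 * Y2 + X1 * Y1 + X2 * Y0) * z ^+ 2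
    + (X1 * Y2 + X2 * Y1) * z ^+ 3 + X2 * Y2 * z ^+ 4); first by ring.
  by rewrite z3 z4; ring.
have coI k : co (iota k) = (k, 0, 0).
  by apply: co_uniq; rewrite /= !rmorph0 !mul0r !addr0.
pose N x := cubic_norm c (co x).
have NM x y : N (x * y) = N x * N y by rewrite /N coM cubic_normM.
(* The norm cubes elements of the base field; this is the source of the index 3. *)
have NI k : N (iota k) = k ^+ 3 by rewrite /N coI /cubic_norm /=; ring.
have N1 : N 1 = 1 by rewrite -(rmorph1 iota) NI expr1n.
have N0 x : x != 0 -> N x != 0.
  move=> x0; apply/eqP => Nx; have := NM x x^-1.
  by rewrite divff // N1 Nx mul0r => /eqP; rewrite oner_eq0.
have Nz : N z = - c ^+ 2.
  have -> : N z = cubic_norm c (0, 1, 0).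
    by rewrite /N (@co_uniq z (0, 1, 0)) //= !rmorph0 rmorph1 mul0r mul1r addr0 add0r.
  by rewrite /cubic_norm /=; ring.
have NV x : N x^-1 = (N x)^-1.
  have [->|x0] := eqVneq x 0; first by rewrite !invr0 -(rmorph0 iota) NI expr0n invr0.
  by apply: (mulIf (N0 _ x0)); rewrite -NM !mulVf ?N0.
have m0 : 0 < - v c by lia.
have m3 k : - v c <> 3 * k by have := vc3 (k := - k); lia.
have vc : v c = - - v c by rewrite opprK.
have OQE x := cubic_norm_ring valP nv char3 c0 vc m0 m3 (co x).
(* Up to powers of [c], [OQE] bounds the cubes of the coordinates, and cubing is additive in
   characteristic 3; hence [OQ] is closed under subtraction. *)
have cube_sub (x y : K) : (x - y) ^+ 3 = x ^+ 3 - y ^+ 3.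
  have -> : (x - y) ^+ 3 = x ^+ 3 - y ^+ 3 + 3%:R * (x * y ^+ 2 - x ^+ 2 * y) by ring.
  by rewrite char3 mul0r addr0.
pose OQ : set L := [set x | place_ring P (N x)]%classic.
have [t t0 vt] := nv_uniformizer nv.
have valQ : valuation_ring (ext_const i L) OQ.
  split; first split.
  - by rewrite /OQ /= N1; exact: (vring1 valP).
  - move=> x y /OQE[x0 x1 x2] /OQE[y0 y1 y2]; apply/OQE.
    have -> : co (x - y) = ((co x).1.1 - (co y).1.1, (co x).1.2 - (co y).1.2, (co x).2 - (co y).2).
      by apply: co_uniq; rewrite {1}(coE x) {1}(coE y) !rmorphB; ring.
    by rewrite /= !cube_sub !mulrBr; split; apply: (vgeB valP nv).
  - by move=> x y Ox Oy; rewrite /OQ /= NM; exact: (vringM valP).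
  - split=> [_ [k _ <-]|sub].
      rewrite /OQ /= /ext_const -iotaE NI; apply/(vringX valP)/(vring_const valP).
    (* The inclusion of the constants is strict: [iota t] is no constant, since the inverse of a
       constant lies in the ring of [P]. *)
    have /sub[k _] : OQ (iota t).
      by rewrite /OQ /= NI; apply: (vringX valP); apply/(nvO nv) => //; rewrite vt.
    rewrite /ext_const -iotaE => /fmorph_inj kt.
    have : place_ring P t^-1 by rewrite -kt -fmorphV; exact: (vring_const valP).
    by rewrite (nvO nv) ?invr_eq0 // (nvV nv) // vt.
  - split=> // sub; have : OQ (iota t^-1) by exact: sub.
    rewrite /OQ /= NI (nvO nv) ?expf_neq0 ?invr_eq0 //.
    by rewrite (nvX nv) ?invr_eq0 // (nvV nv) // vt.
  - by move=> x; rewrite /OQ /= NV; exact: (vring_or valP).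
have nvQ : normalized_valuation OQ (fun x => v (N x)).
  split=> [x y x0 y0|x x0|].
  - by rewrite NM (nvM nv) ?N0.
  - by rewrite -(nvO nv) ?N0.
  have z0 : z != 0.
    apply/eqP => ze; move: Nz; rewrite ze -(rmorph0 iota) NI expr0n /= => /eqP.
    by rewrite eq_sym oppr_eq0 expf_eq0 (negPf c0).
  have vNz : v (N z) = 2 * v c by rewrite Nz (nvN nv) (nvX nv).
  have NX x n : N (x ^+ n) = N x ^+ n.
    by elim: n => [|n IH]; rewrite ?N1 // !exprS NM IH.
  (* Bezout coefficients: [N z] has value [2 * v c], prime to 3, and [N (iota t)] has value 3, so
     [z ^+ a * iota (t ^ b)] has value 1. The choice of [a] depends on [v c] modulo 3. *)
  have [a [b ab]] : exists (a : nat) (b : int), a%:Z * (2 * v c) + 3 * b = 1.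
    have := vc3 (k := (v c %/ 3)%Z); have := divz_eq (v c) 3.
    have : 0 <= (v c %% 3)%Z by exact: modz_ge0.
    have : (v c %% 3)%Z < 3 by exact: ltz_pmod.
    case: (v c %% 3)%Z => [[|[|[|r]]]|r] //; set q := (v c %/ 3)%Z => _ _ e ne.
    + by case: ne; rewrite {1}e; lia.
    + by exists 2, (- 4 * q - 1); rewrite e; lia.
    + by exists 1%N, (- 2 * q - 1); rewrite e; lia.
  exists (z ^+ a * iota (t ^ b)).
    by rewrite mulf_neq0 ?expf_neq0 ?fmorph_eq0 ?expfz_neq0.
  rewrite NM NX NI (nvM nv) ?expf_neq0 ?N0 ?expfz_neq0 // !(nvX nv) ?N0 ?expfz_neq0 //.
  by rewrite vNz (nvXz nv) // vt; lia.
pose Q := Place valQ; have nvQ' : normalized_valuation (place_ring Q) (fun x => v (N x)) := nvQ.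
have VI x : x != 0 -> v (N (iota x)) = 3 * v x by move=> x0; rewrite NI (nvX nv).
exists Q; split.
  move=> x /(place_idealP nv) gx; apply/(place_idealP nvQ').
  have [->|x0] := eqVneq x 0; first by left; rewrite -iotaE rmorph0.
  case: gx => [/eqP|gx]; first by rewrite (negPf x0).
  by right; rewrite -iotaE VI //; lia.
(* The index is unique because it can be read off at [t], where [v] is 1. *)
apply: xget_unique => [x x0|e He].
  by rewrite (pvalE nvQ') -?iotaE ?fmorph_eq0 // (pvalE nv) // VI.
have := He t t0; rewrite (pvalE nvQ') -?iotaE ?fmorph_eq0 // (pvalE nv) // VI // vt.
by lia.
Qed.

End EisensteinPlace.

(** * Values prime to 3, and twists of the generator [y] *)

Lemma gcdz3P (n : int) : gcdz n 3 = 1 <-> forall k, n <> 3 * k.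
Proof.
have -> : gcdz n 3 = 1 <-> coprime 3 `|n|%N.
  by rewrite /gcdz /coprime gcdnC; split=> [[->]|/eqP->].
rewrite prime_coprime //; split=> [n3 k nE|n3].
  by case/negP: n3; rewrite nE abszM dvdn_mulr.
apply/negP => /dvdnP[k nk]; have [n0|n0] := lerP 0 n.
  by apply: (n3 k%:Z); lia.
by apply: (n3 (- k%:Z)); lia.
Qed.

Section CubicTwist.
Variables (F K : fieldType) (i : {rmorphism F -> K}) (L : fieldExtType K).
Variables (P : place i) (v : K -> int) (y : L) (a : K).
Hypotheses (nv : normalized_valuation (place_ring P) v) (char3 : 3%:R = 0 :> K).
Hypotheses (dimL : \dim {:L} = 3%N) (gen : generator_with_minpoly y a).

Lemma generator_notin1 k : y <> in_alg L k.
Proof.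
move=> yk; have [|_ /eqP] := generator_free gen (u0 := - k) (u1 := 1) (u2 := 0).
  by rewrite rmorphN rmorph1 rmorph0 yk mul1r mul0r addr0 addNr.
by rewrite oner_eq0.
Qed.

Lemma minpoly_coef_neq0 : a != 0.
Proof.
apply/eqP => a0; have := generator_root gen.
rewrite a0 rmorph0 mul0r expr0n !addr0 => /eqP; rewrite expf_eq0 /= => /eqP y0.
by apply: (@generator_notin1 0); rewrite rmorph0.
Qed.

(** A negative [pval] is not the default, so [x] is a power of a uniformizer times a unit. *)
Lemma pval_lt0 x : pval P x < 0 -> x != 0.
Proof.
move=> px; apply/eqP => x0.
have [|t [u [/(uniformizerP nv)[t0 _] [_ u0 _] /eqP]]] := @pval_neq0 _ _ _ P x.
  by move=> p0; rewrite p0 in px.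
by rewrite x0 eq_sym mulf_eq0 (negPf u0) orbF (negPf (expfz_neq0 _ t0)).
Qed.

(** The element y' = w - j y, which is w + y for j = 2, satisfies y'^3 + a y' = c, as cubing is
    additive in characteristic 3. Scaling it by - c / a^2 gives the equation with coefficient c^2 /
    a^3. *)
Lemma twisted_generator (w : K) (j : nat) : j = 1%N \/ j = 2%N ->
  let c := j%:R * a ^+ 2 + (w ^+ 3 + a * w) in
  c != 0 -> exists z : L, generator_with_minpoly z (c ^+ 2 / a ^+ 3).
Proof.
move=> j12 c c0; have a0 := minpoly_coef_neq0.
pose iota : {rmorphism K -> L} := in_alg L.
have ynot k : y <> iota k := @generator_notin1 k.
have ry : y ^+ 3 + iota a * y + iota a ^+ 2 = 0 := generator_root gen.
have L3 : 3%:R = 0 :> L by rewrite -(rmorph_nat iota) char3 rmorph0.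
have [y' [y'E [k [e ye]]]] : exists y' : L, y' ^+ 3 + iota a * y' = iota c /\
    exists k e, y = iota e * y' + iota k.
  have cE : iota c = j%:R * iota a ^+ 2 + (iota w ^+ 3 + iota a * iota w).
    by rewrite /c !(rmorphD, rmorphM, rmorphXn, rmorph_nat).
  case: j12 cE => -> ->.
    exists (iota w - y); split; last by exists w, (-1); rewrite rmorphN1; ring.
    have -> : (iota w - y) ^+ 3 + iota a * (iota w - y) =
       iota w ^+ 3 + iota a * iota w + iota a ^+ 2 - (y ^+ 3 + iota a * y + iota a ^+ 2)
       + 3%:R * (iota w * y ^+ 2 - iota w ^+ 2 * y) by ring.
    by rewrite ry L3; ring.
  exists (iota w + y); split; last by exists (- w), 1; rewrite rmorphN rmorph1; ring.
  have -> : (iota w + y) ^+ 3 + iota a * (iota w + y) =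
       iota w ^+ 3 + iota a * iota w + 2%:R * iota a ^+ 2 + (y ^+ 3 + iota a * y + iota a ^+ 2)
       + 3%:R * (iota w * y ^+ 2 + iota w ^+ 2 * y - iota a ^+ 2) by ring.
  by rewrite ry L3; ring.
clearbody c; have ia0 : iota a != 0 by rewrite fmorph_eq0.
exists (- (iota c / iota a ^+ 2) * y').
apply: cubic_generator => //; last first.
  rewrite -[in_alg L _]/(iota _) fmorph_div !rmorphXn.
  have y3 : y' ^+ 3 = iota c - iota a * y' by rewrite -y'E addrK.
  rewrite exprMn y3; field; exact: ia0.
(* If the scaled element were in the base field, so would be [y], which is an affine function of
   [y']. *)
apply/negP => /vlineP[l lE].
have ic0 : iota c != 0 by rewrite fmorph_eq0.
apply: (ynot (- e * (a ^+ 2 / c) * l + k)).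
rewrite [LHS]ye; have -> : y' = - (iota a ^+ 2 / iota c) * iota l.
  by rewrite -[iota l]lE; field; rewrite ia0 ic0.
by rewrite !(rmorphD, rmorphM, rmorphN, fmorphV, rmorphXn); field; exact: ic0.
Qed.

(** Here c = - (y'^3 + a y') with [V y'] prime to 3. If the value of the linear term did not exceed
    that of the cube, [V y'] would be divisible by 3: either the two values agree, or the linear
    term has the value of [c], a multiple of 3. *)
Lemma fully_ramified_twist : fully_ramified L P ->
  exists (w : K) (j : nat), (j = 1%N \/ j = 2%N) /\
       let alpha := (j%:R * a ^+ 2 + (w ^+ 3 + a * w)) ^+ 2 / a ^+ 3 in
       pval P alpha < 0 /\ gcdz (pval P alpha) 3 = 1.
Proof.
move=> /(fully_ramified_valuation nv dimL)[Q [V [nvQ VI]]].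
have a0 := minpoly_coef_neq0.
have [w [yw0 Vyw]] := exists_val_coprime3 (iota := in_alg L) (place_ringP Q) nvQ VI
  (nv_elt nv) (fun b => dim_relation b dimL) (generator_coords gen).
have [iota iotaE] : exists io : {rmorphism K -> L}, forall k, io k = in_alg L k.
  by exists (in_alg L).
have {}VI x : x != 0 -> V (iota x) = 3 * v x by rewrite iotaE; exact: VI.
have ry := generator_root gen; rewrite -iotaE in ry.
have {}yw0 : y - iota w != 0 by rewrite iotaE.
have {}Vyw m : V (y - iota w) <> 3 * m by rewrite iotaE; exact: Vyw.
exists w, 1%N; split; first by left.
set c := _ + (w ^+ 3 + _) => /=; pose y' := y - iota w.
have L3 : 3%:R = 0 :> L by rewrite -(rmorph_nat iota) char3 rmorph0.
have cE : iota c = - (y' ^+ 3 + iota a * y').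
  rewrite /c /y' !(rmorphD, rmorphM, rmorphXn, rmorph_nat).
  transitivity (- ((y - iota w) ^+ 3 + iota a * (y - iota w)) +
    (y ^+ 3 + iota a * y + iota a ^+ 2)
    - 3%:R * (iota w * y ^+ 2 - iota w ^+ 2 * y)); first by ring.
  by rewrite ry L3; ring.
have V1 : V (y' ^+ 3) = 3 * V y' by rewrite (nvX nvQ).
have V2 : V (iota a * y') = 3 * v a + V y' by rewrite (nvM nvQ) ?fmorph_eq0 // VI.
have y'30 : y' ^+ 3 != 0 by rewrite expf_neq0.
have ay'0 : iota a * y' != 0 by rewrite mulf_neq0 ?fmorph_eq0.
have valQ := place_ringP Q.
have [lt|] := ltrP (3 * V y') (3 * v a + V y').
  have [|s0 Vs] := nv_dominant valQ nvQ y'30 (y := iota a * y').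
    by right; rewrite V1 V2; lia.
  have c0 : c != 0 by rewrite -(fmorph_eq0 iota) cE oppr_eq0.
  have vc : v c = V y' by have := VI _ c0; rewrite cE (nvN nvQ) Vs V1; lia.
  have -> : pval P (c ^+ 2 / a ^+ 3) = 2 * V y' - 3 * v a.
    rewrite (pvalE nv) ?mulf_neq0 ?invr_eq0 ?expf_neq0 //.
    by rewrite (nvM nv) ?(nvV nv) ?invr_eq0 ?expf_neq0 // !(nvX nv) // vc.
  (* The case assumption amounts to [2 * V y' < 3 * v a]. *)
  split; first lia.
  by apply/gcdz3P => k; have := Vyw (V y' - v a - k); rewrite -/y'; lia.
rewrite le_eqVlt => /orP[/eqP e|lt].
  by have := Vyw (V y' - v a); rewrite -/y'; lia.
have [|s0 Vs] := nv_dominant valQ nvQ ay'0 (y := y' ^+ 3).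
  by right; rewrite V1 V2; lia.
have c0 : c != 0 by rewrite -(fmorph_eq0 iota) cE addrC oppr_eq0.
have := VI _ c0; rewrite cE (nvN nvQ) addrC Vs V2 => e.
by have := Vyw (v c - v a); rewrite -/y'; lia.
Qed.

End CubicTwist.

(** * Both equivalences *)

Theorem mainTheorem16 (F : finFieldType) (K : fieldType)
    (i : {rmorphism F -> K}) (L : fieldExtType K) (y : L) (a : K)
    (P : place i) :
  3%N \in [pchar F] ->
  function_field i ->
  full_constant_field i ->
  separable 1%VS {:L}%VS ->
  \dim {:L} = 3%N ->
  generator_with_minpoly y a ->
  (fully_ramified L P <->
     exists (w : K) (j : nat), (j = 1%N \/ j = 2%N) /\
       let alpha := (j%:R * a ^+ 2 + (w ^+ 3 + a * w)) ^+ 2 / a ^+ 3 in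
       pval P alpha < 0 /\ gcdz (pval P alpha) 3 = 1)
  /\
  (fully_ramified L P <->
     exists (z : L) (alpha : K), generator_with_minpoly z alpha /\
       pval P alpha < 0 /\ gcdz (pval P alpha) 3 = 1).
Proof.
move=> charF ffK _ _ dimL gen.
have [v nv] := place_discrete P ffK.
have char3 : 3%:R = 0 :> K by rewrite -(rmorph_nat i) (pcharf0 charF) rmorph0.
have twist_gen : (exists (w : K) (j : nat), (j = 1%N \/ j = 2%N) /\
       let alpha := (j%:R * a ^+ 2 + (w ^+ 3 + a * w)) ^+ 2 / a ^+ 3 in
       pval P alpha < 0 /\ gcdz (pval P alpha) 3 = 1) ->
    exists (z : L) (alpha : K), generator_with_minpoly z alpha /\
       pval P alpha < 0 /\ gcdz (pval P alpha) 3 = 1.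
  move=> [w [j [j12 [alt al3]]]].
  have := pval_lt0 nv alt; rewrite mulf_eq0 negb_or => /andP[c2 _].
  have c0 : j%:R * a ^+ 2 + (w ^+ 3 + a * w) != 0 by move: c2; rewrite expf_eq0.
  have [z genz] := twisted_generator char3 dimL gen j12 c0.
  by exists z, ((j%:R * a ^+ 2 + (w ^+ 3 + a * w)) ^+ 2 / a ^+ 3).
have gen_ram : (exists (z : L) (alpha : K), generator_with_minpoly z alpha /\
       pval P alpha < 0 /\ gcdz (pval P alpha) 3 = 1) -> fully_ramified L P.
  move=> [z [al [genz [alt /gcdz3P al3]]]]; have al0 := pval_lt0 nv alt.
  by rewrite (pvalE nv) // in alt al3; exact: eisenstein_fully_ramified nv char3 genz al0 alt al3.
have ram_twist := fully_ramified_twist nv char3 dimL gen.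
(* Ramification gives a twist, a twist gives a generator, and a generator gives ramification; both
   equivalences follow from this cycle. *)
by split; split=> H; auto.
Qed.
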